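(* Consider the $s$-stage weak Runge-Kutta method $$Q^{(0)}_i=q_k+\Delta t\sum_{j=1}^sa^{(0)}_{ij}\frac{\partial H}{\partial p}(Q^{(0)}_j,P^{(0)}_j)+\sum_{r=1}^m\hat I_r\sum_{j=1}^sb^{(0)}_{ij}\frac{\partial h_r}{\partial p}(Q^{(r)}_j,P^{(r)}_j),$$ $$P^{(0)}_i=p_k+\Delta t\sum_{j=1}^sa^{(0)}_{ij}\Big[-\frac{\partial H}{\partial q}+F\Big](Q^{(0)}_j,P^{(0)}_j)+\sum_{r=1}^m\hat I_r\sum_{j=1}^sb^{(0)}_{ij}\Big[-\frac{\partial h_r}{\partial q}+f_r\Big](Q^{(r)}_j,P^{(r)}_j),$$ $$Q^{(l)}_i=q_k+\Delta t\sum_{j=1}^sa^{(1)}_{ij}\frac{\partial H}{\partial p}(Q^{(0)}_j,P^{(0)}_j)+\hat I_l\sum_{j=1}^sb^{(1)}_{ij}\frac{\partial h_l}{\partial p}(Q^{(l)}_j,P^{(l)}_j)+\sum_{r=1,\,r\ne l}^m\hat I_r\sum_{j=1}^sb^{(3)}_{ij}\frac{\partial h_r}{\partial p}(Q^{(r)}_j,P^{(r)}_j),$$ $$P^{(l)}_i=p_k+\Delta t\sum_{j=1}^sa^{(1)}_{ij}\Big[-\frac{\partial H}{\partial q}+F\Big](Q^{(0)}_j,P^{(0)}_j)+\hat I_l\sum_{j=1}^sb^{(1)}_{ij}\Big[-\frac{\partial h_l}{\partial q}+f_l\Big](Q^{(l)}_j,P^{(l)}_j)+\sum_{r=1,\,r\ne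 l}^m\hat I_r\sum_{j=1}^sb^{(3)}_{ij}\Big[-\frac{\partial h_r}{\partial q}+f_r\Big](Q^{(r)}_j,P^{(r)}_j),$$ for $i=1,\ldots,s$ and $l=1,\ldots,m$, together with $$q_{k+1}=q_k+\Delta t\sum_{i=1}^s\alpha_i\frac{\partial H}{\partial p}(Q^{(0)}_i,P^{(0)}_i)+\sum_{r=1}^m\hat I_r\sum_{i=1}^s\beta_i\frac{\partial h_r}{\partial p}(Q^{(r)}_i,P^{(r)}_i),$$ $$p_{k+1}=p_k+\Delta t\sum_{i=1}^s\alpha_i\Big[-\frac{\partial H}{\partial q}+F\Big](Q^{(0)}_i,P^{(0)}_i)+\sum_{r=1}^m\hat I_r\sum_{i=1}^s\beta_i\Big[-\frac{\partial h_r}{\partial q}+f_r\Big](Q^{(r)}_i,P^{(r)}_i),$$ whose real coefficients satisfy, for all $i,j=1,\ldots,s$, $$\alpha_ia^{(0)}_{ij}+\alpha_ja^{(0)}_{ji}=\alpha_i\alpha_j,\quad \alpha_ib^{(0)}_{ij}+\beta_ja^{(1)}_{ji}=\alpha_i\beta_j,\quad \beta_ib^{(1)}_{ij}+\beta_jb^{(1)}_{ji}=\beta_i\beta_j,\quad \beta_ib^{(3)}_{ij}+\beta_jb^{(3)}_{ji}=\beta_i\beta_j.$$ Then this method is a stochastic Lagrange-d'Alembert variational integrator, i.e. it satisfies $$q_{k+1}=D_2H^+_d(q_k,p_{k+1})-F^+_d(q_k,p_{k+1}),\qquad p_k=D_1H^+_d(q_k,p_{k+1})-F^-_d(q_k,p_{k+1}),$$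 with the discrete Hamiltonian $$H^+_d(q_k,p_{k+1})=p_{k+1}q_{k+1}-\Delta t\sum_{i=1}^s\alpha_i\Big(P^{(0)}_i\frac{\partial H}{\partial p}(Q^{(0)}_i,P^{(0)}_i)-H(Q^{(0)}_i,P^{(0)}_i)\Big)-\sum_{r=1}^m\hat I_r\sum_{i=1}^s\beta_i\Big(P^{(r)}_i\frac{\partial h_r}{\partial p}(Q^{(r)}_i,P^{(r)}_i)-h_r(Q^{(r)}_i,P^{(r)}_i)\Big)$$ and the discrete forces $$F^-_d(q_k,p_{k+1})=\Delta t\sum_{i=1}^s\alpha_i\Big(\frac{\partial Q^{(0)}_i}{\partial q_k}\Big)^TF(Q^{(0)}_i,P^{(0)}_i)+\sum_{r=1}^m\hat I_r\sum_{i=1}^s\beta_i\Big(\frac{\partial Q^{(r)}_i}{\partial q_k}\Big)^Tf_r(Q^{(r)}_i,P^{(r)}_i),$$ $$F^+_d(q_k,p_{k+1})=\Delta t\sum_{i=1}^s\alpha_i\Big(\frac{\partial Q^{(0)}_i}{\partial p_{k+1}}\Big)^TF(Q^{(0)}_i,P^{(0)}_i)+\sum_{r=1}^m\hat I_r\sum_{i=1}^s\beta_i\Big(\frac{\partial Q^{(r)}_i}{\partial p_{k+1}}\Big)^Tf_r(Q^{(r)}_i,P^{(r)}_i),$$ where $q_{k+1}$, $p_k$, $Q^{(0)}_i$, $Q^{(r)}_i$, $P^{(0)}_i$, $P^{(r)}_i$ satisfy the Runge-Kutta equations above and are understood as functions of $q_k$ and $p_{k+1}$.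
   Context: The method discretizes the stochastic forced Hamiltonian system on $T^*Q\cong\mathbb{R}^N\times\mathbb{R}^N$ $$d_t q = \frac{\partial H}{\partial p}\,dt + \sum_{r=1}^m\frac{\partial h_r}{\partial p}\circ dW^r(t),\qquad d_t p = \Big[-\frac{\partial H}{\partial q} + F(q,p)\Big] dt + \sum_{r=1}^m \Big[-\frac{\partial h_r}{\partial q}+f_r(q,p)\Big]\circ dW^r(t),$$ where $H,h_1,\ldots,h_m:\mathbb{R}^N\times\mathbb{R}^N\to\mathbb{R}$, $F,f_1,\ldots,f_m:\mathbb{R}^N\times\mathbb{R}^N\to\mathbb{R}^N$, $W$ is a standard $m$-dimensional Wiener process, and $\circ$ denotes Stratonovich integration. Standing assumptions: $H$ and all $h_r$ are $C^2$, $F$ and all $f_r$ are $C^1$, and the drift and diffusion coefficients of the It\^o form of the system are globally Lipschitz. $\Delta t>0$ is the time step; $\hat I_1,\ldots,\hat I_m$ are independent random variables with $P(\hat I_r=\pm\sqrt{3\Delta t})=1/6$ and $P(\hat I_r=0)=2/3$; $Q^{(0)}_i,Q^{(l)}_i,P^{(0)}_i,P^{(l)}_i\in\mathbb{R}^N$ are internal stages. The notation $[-\frac{\partial H}{\partial q}+F](Q,P)$ means $-\frac{\partial H}{\partial q}(Q,P)+F(Q,P)$, and similarly for $h_r,f_r$. Products of vectors such as $p_{k+1}q_{k+1}$ and $P_i\frac{\partial H}{\partial p}$ are scalar products; $D_1,D_2$ are the (column-vector) derivatives with respect to the first argument $q_k$ and second argument $p_{k+1}$; $\partial Q/\partial q_k$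 and $\partial Q/\partial p_{k+1}$ are Jacobian matrices. *)

(* Defs.v *)
From HB Require Import structures.
From mathcomp Require Import all_boot all_order all_algebra.
From mathcomp Require Import all_classical all_reals all_analysis.
Import Order.TTheory GRing.Theory Num.Theory.
Import numFieldNormedType.Exports.

Set Implicit Arguments.
Unset Strict Implicit.
Unset Printing Implicit Defensive.

Local Open Scope classical_set_scope.
Local Open Scope ring_scope.

Definition dotv (R : realType) (n : nat) (u v : 'cV[R]_n) : R :=
  \sum_(i < n) u i 0 * v i 0.

(* [MathComp-Analysis]'s ['J f x] is for row vectors and is the transpose of
   the usual Jacobian; here rows index components and columns variables. *)
Definition jac (R : realType) (n k : nat) (f : 'cV[R]_n -> 'cV[R]_k)
    (x : 'cV[R]_n) : 'M[R]_(k, n) :=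
  \matrix_(i < k, j < n) ('D_(delta_mx j 0) f x) i 0.

Definition grad (R : realType) (n : nat) (f : 'cV[R]_n -> R)
    (x : 'cV[R]_n) : 'cV[R]_n :=
  \col_(i < n) 'D_(delta_mx i 0) f x.

Notation phase R N := ('cV[R]_N * 'cV[R]_N)%type.

Definition grad1 (R : realType) (N : nat) (f : phase R N -> R)
    (z : phase R N) : 'cV[R]_N := grad (fun x => f (x, z.2)) z.1.

Definition grad2 (R : realType) (N : nat) (f : phase R N -> R)
    (z : phase R N) : 'cV[R]_N := grad (fun y => f (z.1, y)) z.2.

Definition jac1 (R : realType) (N k : nat) (f : phase R N -> 'cV[R]_k)
    (z : phase R N) : 'M[R]_(k, N) := jac (fun x => f (x, z.2)) z.1.

Definition jac2 (R : realType) (N k : nat) (f : phase R N -> 'cV[R]_k)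
    (z : phase R N) : 'M[R]_(k, N) := jac (fun y => f (z.1, y)) z.2.

(* In finite dimension, continuity of [x |-> 'D_v f x] for every [v] is
   continuity of the differential. *)
Definition C1 (R : realType) (V W : normedModType R) (f : V -> W) : Prop :=
  (forall x, differentiable f x) /\ (forall v, continuous ('D_v f)).

Definition C2 (R : realType) (V W : normedModType R) (f : V -> W) : Prop :=
  C1 f /\ (forall v, C1 ('D_v f)).

Record forced_system (R : realType) (N m : nat) := ForcedSystem {
  ham : phase R N -> R;
  sham : 'I_m -> phase R N -> R;
  force : phase R N -> 'cV[R]_N;
  sforce : 'I_m -> phase R N -> 'cV[R]_N }.

Section System.
Variables (R : realType) (N m : nat) (Sys : forced_system R N m).
Local Notation vec := 'cV[R]_N.

Definition drift_q (z : phase R N) : vec := grad2 (ham Sys) z.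
Definition drift_p (z : phase R N) : vec := - grad1 (ham Sys) z + force Sys z.
Definition diff_q (r : 'I_m) (z : phase R N) : vec := grad2 (sham Sys r) z.
Definition diff_p (r : 'I_m) (z : phase R N) : vec :=
  - grad1 (sham Sys r) z + sforce Sys r z.

Definition drift (z : phase R N) : phase R N := (drift_q z, drift_p z).
Definition diffusion (r : 'I_m) (z : phase R N) : phase R N :=
  (diff_q r z, diff_p r z).

(* The correction term converts the Stratonovich form to the Ito form. *)
Definition ito_drift (z : phase R N) : phase R N :=
  drift z + 2^-1 *: \sum_(r < m) 'D_(diffusion r z) (diffusion r) z.

Definition standing_assumptions : Prop :=
  [/\ C2 (ham Sys) /\ (forall r, C2 (sham Sys r)),
      C1 (force Sys) /\ (forall r, C1 (sforce Sys r)),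
      lipschitz ito_drift
    & forall r, lipschitz (diffusion r)].

End System.

Section Increments.
Variables (d : measure_display) (Omega : measurableType d) (R : realType).
Variables (Pr : probability Omega R) (m : nat).

Definition mutually_independent (X : 'I_m -> {RV Pr >-> R}) : Prop :=
  forall (J : {set 'I_m}) (B : 'I_m -> set R),
    (forall r, measurable (B r)) ->
    Pr (\bigcap_(r in [set` J]) (X r @^-1` B r)) =
    (\prod_(r in J) Pr (X r @^-1` B r))%E.

Definition three_point_law (dt : R) (X : {RV Pr >-> R}) : Prop :=
  [/\ Pr [set w | X w = Num.sqrt (3 * dt)] = (6^-1)%:E,
      Pr [set w | X w = - Num.sqrt (3 * dt)] = (6^-1)%:E
    & Pr [set w | X w = 0] = (2 / 3)%:E].

End Increments.

Record rk_coeffs (R : realType) (s : nat) := RKCoeffs {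
  a0 : 'I_s -> 'I_s -> R;
  a1 : 'I_s -> 'I_s -> R;
  b0 : 'I_s -> 'I_s -> R;
  b1 : 'I_s -> 'I_s -> R;
  b3 : 'I_s -> 'I_s -> R;
  alpha : 'I_s -> R;
  beta : 'I_s -> R }.

Definition rk_conditions (R : realType) (s : nat) (c : rk_coeffs R s) : Prop :=
  forall i j : 'I_s,
  [/\ alpha c i * a0 c i j + alpha c j * a0 c j i = alpha c i * alpha c j,
      alpha c i * b0 c i j + beta c j * a1 c j i = alpha c i * beta c j,
      beta c i * b1 c i j + beta c j * b1 c j i = beta c i * beta c j
    & beta c i * b3 c i j + beta c j * b3 c j i = beta c i * beta c j].

Section Method.
Variables (R : realType) (N m s : nat).
Variables (Sys : forced_system R N m) (c : rk_coeffs R s) (dt : R) (xi : 'I_m -> R).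
Local Notation vec := 'cV[R]_N.

Definition rk_stage0 (g : phase R N -> vec) (gr : 'I_m -> phase R N -> vec)
    (x : vec) (Q0 P0 : 'I_s -> vec) (Q P : 'I_m -> 'I_s -> vec)
    (i : 'I_s) : vec :=
  x + dt *: (\sum_(j < s) a0 c i j *: g (Q0 j, P0 j))
    + \sum_(r < m) xi r *: (\sum_(j < s) b0 c i j *: gr r (Q r j, P r j)).

Definition rk_stage (g : phase R N -> vec) (gr : 'I_m -> phase R N -> vec)
    (x : vec) (Q0 P0 : 'I_s -> vec) (Q P : 'I_m -> 'I_s -> vec)
    (l : 'I_m) (i : 'I_s) : vec :=
  x + dt *: (\sum_(j < s) a1 c i j *: g (Q0 j, P0 j))
    + xi l *: (\sum_(j < s) b1 c i j *: gr l (Q l j, P l j))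
    + \sum_(r < m | r != l)
        xi r *: (\sum_(j < s) b3 c i j *: gr r (Q r j, P r j)).

Definition rk_update (g : phase R N -> vec) (gr : 'I_m -> phase R N -> vec)
    (x : vec) (Q0 P0 : 'I_s -> vec) (Q P : 'I_m -> 'I_s -> vec) : vec :=
  x + dt *: (\sum_(i < s) alpha c i *: g (Q0 i, P0 i))
    + \sum_(r < m) xi r *: (\sum_(i < s) beta c i *: gr r (Q r i, P r i)).

Definition rk_step (q p q' p' : vec) (Q0 P0 : 'I_s -> vec)
    (Q P : 'I_m -> 'I_s -> vec) : Prop :=
  [/\ forall i,
        Q0 i = rk_stage0 (drift_q Sys) (diff_q Sys) q Q0 P0 Q P i /\
        P0 i = rk_stage0 (drift_p Sys) (diff_p Sys) p Q0 P0 Q P i,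
      forall l i,
        Q l i = rk_stage (drift_q Sys) (diff_q Sys) q Q0 P0 Q P l i /\
        P l i = rk_stage (drift_p Sys) (diff_p Sys) p Q0 P0 Q P l i,
      q' = rk_update (drift_q Sys) (diff_q Sys) q Q0 P0 Q P
    & p' = rk_update (drift_p Sys) (diff_p Sys) p Q0 P0 Q P].

(* From here on a point [z] is the pair (q_k, p_{k+1}), and the remaining
   quantities are functions of it: [qn] is q_{k+1} and [pk] is p_k. *)
Variables (qn pk : phase R N -> vec).
Variables (Q0 P0 : 'I_s -> phase R N -> vec).
Variables (Q P : 'I_m -> 'I_s -> phase R N -> vec).

Definition rk_method_on (U : set (phase R N)) : Prop :=
  forall z, U z ->
    rk_step z.1 (pk z) (qn z) z.2 (Q0 ^~ z) (P0 ^~ z)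
      (fun r i => Q r i z) (fun r i => P r i z).

Definition differentiable_stages_on (U : set (phase R N)) : Prop :=
  forall z, U z ->
    (forall i, differentiable (Q0 i) z /\ differentiable (P0 i) z) /\
    (forall r i, differentiable (Q r i) z /\ differentiable (P r i) z).

Definition discrete_ham (z : phase R N) : R :=
  dotv z.2 (qn z)
  - dt * (\sum_(i < s) alpha c i *
      (dotv (P0 i z) (grad2 (ham Sys) (Q0 i z, P0 i z))
       - ham Sys (Q0 i z, P0 i z)))
  - \sum_(r < m) xi r * (\sum_(i < s) beta c i *
      (dotv (P r i z) (grad2 (sham Sys r) (Q r i z, P r i z))
       - sham Sys r (Q r i z, P r i z))).

Definition discrete_force_minus (z : phase R N) : vec :=
  dt *: (\sum_(i < s) alpha c i *:
      ((jac1 (Q0 i) z)^T *m force Sys (Q0 i z, P0 i z)))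
  + \sum_(r < m) xi r *: (\sum_(i < s) beta c i *:
      ((jac1 (Q r i) z)^T *m sforce Sys r (Q r i z, P r i z))).

Definition discrete_force_plus (z : phase R N) : vec :=
  dt *: (\sum_(i < s) alpha c i *:
      ((jac2 (Q0 i) z)^T *m force Sys (Q0 i z, P0 i z)))
  + \sum_(r < m) xi r *: (\sum_(i < s) beta c i *:
      ((jac2 (Q r i) z)^T *m sforce Sys r (Q r i z, P r i z))).

End Method.

(* Differentiability of [Hd] is part of the claim: ['D_v] is a default value
   where the derivative does not exist. *)
Definition lagrange_dalembert_integrator_on (R : realType) (N : nat)
    (U : set (phase R N)) (qn pk : phase R N -> 'cV[R]_N)
    (Hd : phase R N -> R) (Fm Fp : phase R N -> 'cV[R]_N) : Prop :=
  forall z, U z ->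
  [/\ differentiable Hd z,
      qn z = grad2 Hd z - Fp z
    & pk z = grad1 Hd z - Fm z].

(* Main.v *)
(* Number all stages by one index set, with [X_k] and [Y_k] the velocities of
   [Q_k] and [P_k]: then [Q_k = q_k + sum_l A_kl X_l], [P_k = p_k + sum_l A_kl Y_l],
   [q_(k+1) = q_k + sum_k w_k X_k], [p_(k+1) = p_k + sum_k w_k Y_k], and the four
   conditions on the coefficients become [w_k A_kl + w_l A_lk = w_k w_l], the
   condition for a Runge-Kutta method to be symplectic. Differentiating the
   discrete Hamiltonian, this condition cancels every term containing [dX], and
   what is left is [q_(k+1) . dp_(k+1) + p_k . dq_k + sum_k w_k f_k . dQ_k]. *)
Require Import Defs.
From HB Require Import structures.
From mathcomp Require Import all_boot all_order all_algebra.
From mathcomp Require Import all_classical all_reals all_analysis.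
From mathcomp Require Import ring.
Import Order.TTheory GRing.Theory Num.Theory.
Import numFieldNormedType.Exports.

Set Implicit Arguments.
Unset Strict Implicit.
Unset Printing Implicit Defensive.

Local Open Scope classical_set_scope.
Local Open Scope ring_scope.

(** * Bilinear algebra of the scalar product *)

Lemma dotvC (R : realType) n (u v : 'cV[R]_n) : dotv u v = dotv v u.
Proof. by apply: eq_bigr => i _; rewrite mulrC. Qed.

Lemma dotvDl (R : realType) n (u1 u2 v : 'cV[R]_n) :
  dotv (u1 + u2) v = dotv u1 v + dotv u2 v.
Proof. by rewrite -big_split; apply: eq_bigr => i _; rewrite mxE mulrDl. Qed.

Lemma dotvDr (R : realType) n (u v1 v2 : 'cV[R]_n) :
  dotv u (v1 + v2) = dotv u v1 + dotv u v2.
Proof. by rewrite dotvC dotvDl !(dotvC _ u). Qed.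

Lemma dotv0l (R : realType) n (v : 'cV[R]_n) : dotv 0 v = 0.
Proof. by apply: big1 => i _; rewrite mxE mul0r. Qed.

Lemma dotv0r (R : realType) n (u : 'cV[R]_n) : dotv u 0 = 0.
Proof. by rewrite dotvC dotv0l. Qed.

Lemma dotvZl (R : realType) n a (u v : 'cV[R]_n) :
  dotv (a *: u) v = a * dotv u v.
Proof. by rewrite mulr_sumr; apply: eq_bigr => i _; rewrite mxE mulrA. Qed.

Lemma dotvZr (R : realType) n a (u v : 'cV[R]_n) :
  dotv u (a *: v) = a * dotv u v.
Proof. by rewrite dotvC dotvZl dotvC. Qed.

Lemma dotvNl (R : realType) n (u v : 'cV[R]_n) : dotv (- u) v = - dotv u v.
Proof. by rewrite -scaleN1r dotvZl mulN1r. Qed.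

Lemma dotv_suml (R : realType) n (I : finType) (u : I -> 'cV[R]_n) v :
  dotv (\sum_i u i) v = \sum_i dotv (u i) v.
Proof.
apply: (big_morph (fun u => dotv u v)); last exact: dotv0l.
by move=> *; exact: dotvDl.
Qed.

Lemma dotv_sumr (R : realType) n (I : finType) (u : 'cV[R]_n) v :
  dotv u (\sum_(i : I) v i) = \sum_i dotv u (v i).
Proof. by rewrite dotvC dotv_suml; apply: eq_bigr => i _; rewrite dotvC. Qed.

Lemma dotv_delta (R : realType) n (u : 'cV[R]_n) i :
  dotv u (delta_mx i 0) = u i 0.
Proof.
rewrite /dotv (bigD1 i)//= mxE !eqxx mulr1 big1 ?addr0// => j ji.
by rewrite mxE (negPf ji) mulr0.
Qed.

(** On the right, [dotv (Y a) (dX b)] occurs with coefficient [w b * A b a] from the first pairing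
    and [w a * A a b] from the second; the symplectic condition makes their sum the [w a * w b] of
    the left-hand product. *)
Lemma rk_pairing (R : realType) n (I : finType) (w : I -> R) (A : I -> I -> R)
    (p dq : 'cV[R]_n) (Y dX : I -> 'cV[R]_n) :
  (forall k l, w k * A k l + w l * A l k = w k * w l) ->
  dotv (p + \sum_k w k *: Y k) (dq + \sum_k w k *: dX k) =
  dotv p dq + \sum_k w k * (dotv (p + \sum_l A k l *: Y l) (dX k)
                            + dotv (Y k) (dq + \sum_l A k l *: dX l)).
Proof.
move=> wA; rewrite dotvDl !dotvDr -!addrA; congr (_ + _).
under [RHS]eq_bigr => k _ do
  rewrite dotvDl dotvDr addrACA mulrDr mulrDr.
rewrite !big_split/= addrA; congr (_ + _).
  rewrite dotv_sumr dotv_suml; congr (_ + _);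
    by apply: eq_bigr => k _; rewrite ?dotvZr ?dotvZl.
under [RHS]eq_bigr => k _ do rewrite dotv_suml dotv_sumr mulrDr !mulr_sumr.
rewrite big_split/= [X in _ = X + _]exchange_big/= -big_split dotv_suml/=.
apply: eq_bigr => k _; rewrite dotv_sumr -big_split/=; apply: eq_bigr => l _.
by rewrite !dotvZl !dotvZr !mulrA -mulrDl -wA addrC.
Qed.

(** * Differentials of sums, coordinates, columns and scalar products *)

(** The first-order expansion only sees values near [x]. This allows differentiating equations that
    hold only on a neighbourhood. *)
Lemma is_diff_near_eq (R : realType) (V W : normedModType R) (f g df : V -> W)
    (x : V) :
  {near x, f =1 g} -> is_diff x f df -> is_diff x g df.
Proof.
move=> fg [df_x <-].
have gx : g x = f x by rewrite (nbhs_singleton fg).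
have dg : g \o shift x = cst (g x) + 'd f x +o_ 0 id.
  have /eqaddoP fo := diff_locally df_x.
  apply/eqaddoP => e e0; have := fo e e0; apply: filter_app.
  by move/nbhs0P: fg; apply: filterS => h fgh; rewrite !fctE/= gx (addrC h x) fgh.
have cf := diff_continuous df_x.
(* ['d g x] is a chosen map: uniqueness identifies it with ['d f x], and differentiability of [g]
   then follows from the expansion. *)
have dgE := diff_unique cf dg.
split; last by rewrite dgE.
by apply/diff_locallyP; rewrite dgE.
Qed.

Lemma is_diff_unique (R : realType) (V W : normedModType R) (f df dg : V -> W)
    (x : V) : is_diff x f df -> is_diff x f dg -> df = dg.
Proof. by move=> [_ <-] [_ <-]. Qed.

Lemma is_diff_sum (R : realType) (V W : normedModType R) (I : finType)
    (f df : I -> V -> W) (x : V) :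
  (forall i, is_diff x (f i) (df i)) ->
  is_diff x (fun y => \sum_i f i y) (fun v => \sum_i df i v).
Proof.
move=> fdf.
rewrite (_ : (fun y => _) = \sum_i f i); last first.
  by apply/funext => y; rewrite fct_sumE.
rewrite (_ : (fun v => _) = \sum_i df i); last first.
  by apply/funext => y; rewrite fct_sumE.
by elim/big_ind2 : _ => [|*|//]; [exact: is_diff_cst|exact: is_diffD].
Qed.

(** A coordinate is a continuous linear map, hence its own differential; the chain rule does the
    rest. *)
Lemma is_diff_coord (R : realType) (V : normedModType R) m n
    (f df : V -> 'M[R]_(m, n)) (x : V) i j :
  is_diff x f df -> is_diff x (fun y => f y i j) (fun v => df v i j).
Proof.
move=> fdf.
have lin : linear (fun M : 'M[R]_(m, n) => M i j) by move=> a M M'; rewrite !mxE.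
pose L : {linear 'M[R]_(m, n) -> R} := HB.pack (fun M : 'M[R]_(m, n) => M i j)
  (GRing.isLinear.Build _ _ _ _ _ lin).
have cL : continuous L by exact: coord_continuous.
have dL : is_diff (f x) L L.
  by split; [exact: linear_differentiable|rewrite diff_lin].
exact: (is_diff_comp fdf dL).
Qed.

Lemma cV_sum_delta (R : realType) n (u : 'cV[R]_n) :
  u = \sum_i u i 0 *: delta_mx i 0.
Proof.
by rewrite [LHS]matrix_sum_delta; apply: eq_bigr => i _; rewrite big_ord1.
Qed.

Lemma is_diff_col (R : realType) (V : normedModType R) n
    (f : V -> 'cV[R]_n) (df : 'I_n -> V -> R) (x : V) :
  (forall i, is_diff x (fun y => f y i 0) (df i)) ->
  is_diff x f (fun v => \col_i df i v).
Proof.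
move=> fdf.
rewrite (_ : f = fun y => \sum_i f y i 0 *: delta_mx i 0); last first.
  by apply/funext => y; rewrite -cV_sum_delta.
rewrite (_ : (fun v => \col_i df i v) =
    fun v => \sum_i df i v *: delta_mx i 0); last first.
  apply/funext => v; rewrite [LHS]cV_sum_delta.
  by apply: eq_bigr => i _; rewrite mxE.
apply: is_diff_sum => i.
exact: (is_diff_comp (fdf i) (is_diff_scalel _ _)).
Qed.

Lemma is_diff_dotv (R : realType) (V : normedModType R) n
    (f df g dg : V -> 'cV[R]_n) (x : V) :
  is_diff x f df -> is_diff x g dg ->
  is_diff x (fun y => dotv (f y) (g y))
    (fun v => dotv (df v) (g x) + dotv (f x) (dg v)).
Proof.
move=> fdf gdg.
apply: (is_diff_eq (is_diff_sum (fun i =>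
  is_diffM (is_diff_coord i 0 fdf) (is_diff_coord i 0 gdg)))).
apply/funext => v; rewrite -big_split/=; apply: eq_bigr => i _.
by rewrite !fctE /= addrC [X in X + _]mulrC.
Qed.

(** * Partial derivatives on phase space *)

(** Both difference quotients are the same function of [t], so the limits agree even where they are
    default values. *)
Lemma derive_fst (R : realType) (U V W : normedModType R) (f : U * V -> W) z u :
  'D_u (fun x => f (x, z.2)) z.1 = 'D_(u, 0) f z.
Proof.
rewrite /derive; congr (lim (_ @ 0^')); apply/funext => t /=.
rewrite -surjective_pairing; congr (_ *: (f _ - _)).
by apply/pair_equal_spec; split; rewrite //= scaler0 add0r.
Qed.

Lemma derive_snd (R : realType) (U V W : normedModType R) (f : U * V -> W) z v :
  'D_v (fun y => f (z.1, y)) z.2 = 'D_(0, v) f z.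
Proof.
rewrite /derive; congr (lim (_ @ 0^')); apply/funext => t /=.
rewrite -surjective_pairing; congr (_ *: (f _ - _)).
by apply/pair_equal_spec; split; rewrite //= scaler0 add0r.
Qed.

Lemma phase_sum_delta (R : realType) n (v : phase R n) :
  v = \sum_i v.1 i 0 *: (delta_mx i 0, 0) + \sum_i v.2 i 0 *: (0, delta_mx i 0).
Proof.
have fstE : {morph (@fst 'cV[R]_n 'cV[R]_n) : x y / x + y} by [].
have sndE : {morph (@snd 'cV[R]_n 'cV[R]_n) : x y / x + y} by [].
apply: injective_projections => /=.
  rewrite (big_morph _ fstE (erefl _)) (big_morph _ fstE (erefl _))/=.
  rewrite [X in _ + X]big1 ?addr0; last by move=> i _; rewrite scaler0.
  exact: cV_sum_delta.
rewrite (big_morph _ sndE (erefl _)) (big_morph _ sndE (erefl _))/=.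
rewrite [X in X + _]big1 ?add0r; last by move=> i _; rewrite scaler0.
exact: cV_sum_delta.
Qed.

Lemma diff_phaseE (R : realType) n (h : phase R n -> R) z v :
  differentiable h z ->
  'd h z v = dotv (grad1 h z) v.1 + dotv (grad2 h z) v.2.
Proof.
move=> dh; rewrite {1}(phase_sum_delta v) linearD !linear_sum.
by congr (_ + _); apply: eq_bigr => i _;
  rewrite linearZ/= mxE ?derive_fst ?derive_snd deriveE// mulrC.
Qed.

(** The components are directional derivatives of [h] along [(0, delta_mx i 0)]; second-order
    smoothness enters here. *)
Lemma differentiable_grad2 (R : realType) n (h : phase R n -> R) z :
  (forall v, differentiable ('D_v h) z) -> differentiable (grad2 h) z.
Proof.
move=> dh; have [] // := @is_diff_col _ _ _ (grad2 h)
  (fun i => 'd ('D_(0, delta_mx i 0) h) z) z _ => i.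
rewrite (_ : (fun y => _) = 'D_(0, delta_mx i 0) h); first exact: differentiableP.
by apply/funext => y; rewrite mxE derive_snd.
Qed.

Lemma is_diff_fst (R : realType) (V W : normedModType R) (x : V * W) :
  is_diff x fst fst.
Proof.
have lin : linear (@fst V W) by [].
pose L : {linear (V * W)%type -> V} := HB.pack (@fst V W)
  (GRing.isLinear.Build _ _ _ _ _ lin).
have cL : continuous L by move=> y; exact: cvg_fst.
suff : is_diff x L L by [].
by split; [exact: linear_differentiable|rewrite diff_lin].
Qed.

Lemma is_diff_snd (R : realType) (V W : normedModType R) (x : V * W) :
  is_diff x snd snd.
Proof.
have lin : linear (@snd V W) by [].
pose L : {linear (V * W)%type -> W} := HB.pack (@snd V W)
  (GRing.isLinear.Build _ _ _ _ _ lin).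
have cL : continuous L by move=> y; exact: cvg_snd.
suff : is_diff x L L by [].
by split; [exact: linear_differentiable|rewrite diff_lin].
Qed.

(* With [X k = dh_k/dp] and [Y k = - dh_k/dq + f_k] at the stages, the terms in
   [dP] cancel, and [rk_pairing] with [dX] the differential of [X] turns the
   remaining ones into [p_k . dq_k]. *)
Lemma is_diff_generating (R : realType) (N : nat) (I : finType)
    (w : I -> R) (A : I -> I -> R) (h : I -> phase R N -> R)
    (f Y : I -> 'cV[R]_N) (qn : phase R N -> 'cV[R]_N) (pk : 'cV[R]_N)
    (Q P : I -> phase R N -> 'cV[R]_N) (z : phase R N) :
  let X k y := grad2 (h k) (Q k y, P k y) in
  (forall k l, w k * A k l + w l * A l k = w k * w l) ->
  (forall k, C2 (h k)) ->
  (forall k, differentiable (Q k) z) -> (forall k, differentiable (P k) z) ->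
  (forall k, \forall y \near z, Q k y = y.1 + \sum_l A k l *: X l y) ->
  (\forall y \near z, qn y = y.1 + \sum_k w k *: X k y) ->
  (forall k, P k z = pk + \sum_l A k l *: Y l) ->
  z.2 = pk + \sum_k w k *: Y k ->
  (forall k, Y k = - grad1 (h k) (Q k z, P k z) + f k) ->
  is_diff z
    (fun y => dotv y.2 (qn y)
              - \sum_k w k * (dotv (P k y) (X k y) - h k (Q k y, P k y)))
    (fun v => dotv v.2 (qn z) + dotv pk v.1
              + \sum_k w k * dotv (f k) ('d (Q k) z v)).
Proof.
move=> X wA hC2 dQ dP QE qnE PE pnE YE.
have dh k y : is_diff y (h k) ('d (h k) y).
  by apply: differentiableP; have [[]] := hC2 k.
have dQP k : is_diff z (fun y => (Q k y, P k y))
    (fun v => ('d (Q k) z v, 'd (P k) z v)).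
  exact: is_diff_pair (differentiableP (dQ k)) (differentiableP (dP k)).
have dX k : is_diff z (X k) ('d (X k) z).
  apply: differentiableP.
  apply: (@differentiable_comp _ _ _ _ (fun y => (Q k y, P k y)) (grad2 (h k)));
    first exact: ex_diff.
  by apply: differentiable_grad2 => v; have [_ /(_ v)[]] := hC2 k.
have dlin (B : I -> R) : is_diff z (fun y => y.1 + \sum_k B k *: X k y)
    (fun v => v.1 + \sum_k B k *: 'd (X k) z v).
  exact: (is_diffD (is_diff_fst z)
    (is_diff_sum (fun k => is_diffZ (B k) (dX k)))).
(* Only the position equations are differentiated, so they are assumed near [z], and the momentum
   equations at [z] alone. *)
have dqn : is_diff z qn (fun v => v.1 + \sum_k w k *: 'd (X k) z v).
  by apply: is_diff_near_eq (dlin w); apply: filterS qnE => y /esym.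
have dQE k v : 'd (Q k) z v = v.1 + \sum_l A k l *: 'd (X l) z v.
  have : is_diff z (Q k) (fun v => v.1 + \sum_l A k l *: 'd (X l) z v).
    by apply: is_diff_near_eq (dlin (A k)); apply: filterS (QE k) => y /esym.
  move=> /(is_diff_unique (differentiableP (dQ k))) dQkE.
  exact: (congr1 (fun g => g v) dQkE).
have dhQP k : is_diff z (fun y => h k (Q k y, P k y))
    (fun v => dotv (grad1 (h k) (Q k z, P k z)) ('d (Q k) z v)
              + dotv (X k z) ('d (P k) z v)).
  apply: is_diff_eq (is_diff_comp (dQP k) (dh k _)) _.
  by apply/funext => v /=; rewrite diff_phaseE//; exact: ex_diff.
have dsum := is_diff_sum (fun k => is_diffZ (w k)
  (is_diffB (is_diff_dotv (differentiableP (dP k)) (dX k)) (dhQP k))).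
apply: is_diff_eq (is_diffB (is_diff_dotv (is_diff_snd z) dqn) dsum) _.
apply/funext => v; rewrite !fctE/= -!addrA; congr (_ + _).
(* The remaining pairing is $p_{k+1}\cdot dq_{k+1}$; [rk_pairing] turns it into [dotv pk v.1] plus a
   sum over stages, compared term by term. *)
rewrite pnE (rk_pairing _ _ _ _ wA) -addrA; congr (_ + _).
rewrite -sumrB; apply: eq_bigr => k _.
rewrite -mulrBr; congr (_ * _).
(* Once the stage sums are folded back into ['d (Q k) z v] and [P k z], the [dX] and [dP] terms
   cancel, and [grad1] from [Y k] cancels the one from [h k]. *)
rewrite -dQE -PE !fctE YE dotvDl dotvNl (dotvC (X k z)).
set a := dotv _ ('d (X k) z v); set b := dotv _ (X k z).
set e := dotv (grad1 _ _) _; set g := dotv (f k) _.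
ring.
Qed.

(** * From the differential to gradients and discrete forces *)

(** Column [i] of the Jacobian is the differential in the [i]-th position direction; this links the
    discrete forces to differentials of the stages. *)
Lemma jac1_tr_mulE (R : realType) n k (g : phase R n -> 'cV[R]_k) z
    (u : 'cV[R]_k) i :
  differentiable g z ->
  ((jac1 g z)^T *m u) i 0 = dotv u ('d g z (delta_mx i 0, 0)).
Proof.
move=> dg; rewrite mxE; apply: eq_bigr => j _.
by rewrite !mxE derive_fst deriveE// mulrC.
Qed.

Lemma jac2_tr_mulE (R : realType) n k (g : phase R n -> 'cV[R]_k) z
    (u : 'cV[R]_k) i :
  differentiable g z ->
  ((jac2 g z)^T *m u) i 0 = dotv u ('d g z (0, delta_mx i 0)).
Proof.
move=> dg; rewrite mxE; apply: eq_bigr => j _.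
by rewrite !mxE derive_snd deriveE// mulrC.
Qed.

(** Position directions kill the pairing with [a], momentum directions the pairing with [b]. In use,
    [a] is $q_{k+1}$ and [b] is $p_k$. *)
Lemma grad_of_is_diff (R : realType) (N : nat) (I : finType) (w : I -> R)
    (Hd : phase R N -> R) (f : I -> 'cV[R]_N) (a b : 'cV[R]_N)
    (Q : I -> phase R N -> 'cV[R]_N) (z : phase R N) :
  (forall k, differentiable (Q k) z) ->
  is_diff z Hd (fun v => dotv v.2 a + dotv b v.1
                         + \sum_k w k * dotv (f k) ('d (Q k) z v)) ->
  grad1 Hd z = b + \sum_k w k *: ((jac1 (Q k) z)^T *m f k) /\
  grad2 Hd z = a + \sum_k w k *: ((jac2 (Q k) z)^T *m f k).
Proof.
move=> dQ [dH HdE]; split; apply/colP => i.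
  rewrite mxE derive_fst deriveE// HdE/= dotv0l add0r dotv_delta !mxE summxE.
  by congr (_ + _); apply: eq_bigr => k _; rewrite [in RHS]mxE jac1_tr_mulE.
rewrite mxE derive_snd deriveE// HdE/= dotv0r addr0 dotvC dotv_delta !mxE summxE.
by congr (_ + _); apply: eq_bigr => k _; rewrite [in RHS]mxE jac2_tr_mulE.
Qed.

(** * All stages as one Runge-Kutta tableau *)

Section Flattening.
Variables (R : realType) (m s : nat).
Local Notation stage := ('I_s + 'I_m * 'I_s)%type.

Definition flatten_stages (T : Type) (x0 : 'I_s -> T) (x : 'I_m -> 'I_s -> T)
    (k : stage) : T :=
  match k with inl i => x0 i | inr (r, i) => x r i end.

Lemma sum_stages (V : nmodType) (F : stage -> V) :
  \sum_k F k = \sum_i F (inl i) + \sum_r \sum_i F (inr (r, i)).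
Proof.
rewrite big_sumType/= pair_bigA/=; congr (_ + _).
by apply: eq_bigr => -[].
Qed.

Variables (c : rk_coeffs R s) (dt : R) (xi : 'I_m -> R).

(** The time step and the increments are absorbed into the coefficients, giving a Runge-Kutta
    tableau of unit step. *)
Definition flat_weight : stage -> R :=
  flatten_stages (fun i => dt * alpha c i) (fun r i => xi r * beta c i).

Lemma sum_flat_weight (V : lmodType R) (F : stage -> V) :
  \sum_k flat_weight k *: F k =
  dt *: (\sum_i alpha c i *: F (inl i))
  + \sum_r xi r *: (\sum_i beta c i *: F (inr (r, i))).
Proof.
rewrite sum_stages scaler_sumr; congr (_ + _).
  by apply: eq_bigr => i _; rewrite scalerA.
apply: eq_bigr => r _; rewrite scaler_sumr.
by apply: eq_bigr => i _; rewrite scalerA.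
Qed.

(** The factor [dt] or [xi r] depends only on the column, that is, on which field is evaluated. *)
Definition flat_matrix (k l : stage) : R :=
  match k, l with
  | inl i, inl j => dt * a0 c i j
  | inl i, inr (r, j) => xi r * b0 c i j
  | inr (_, i), inl j => dt * a1 c i j
  | inr (l, i), inr (r, j) => xi r * (if r == l then b1 c i j else b3 c i j)
  end.

(** Each block carries a common factor [dt * dt], [dt * xi] or [xi * xi], times one of the four
    coefficient conditions. *)
Lemma flat_matrix_symplectic k l : rk_conditions c ->
  flat_weight k * flat_matrix k l + flat_weight l * flat_matrix l k =
  flat_weight k * flat_weight l.
Proof.
move=> cond; case: k l => [i|[r i]] [j|[r' j]] /=;
  have [h0 h01 h1 h3] := cond i j.
- transitivity (dt * dt * (alpha c i * alpha c j)); last by ring.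
  by rewrite -h0; ring.
- transitivity (dt * xi r' * (alpha c i * beta c j)); last by ring.
  by rewrite -h01; ring.
(* The mixed condition is not symmetric, so the transposed block uses it with the indices
   swapped. *)
- have [_ h10 _ _] := cond j i.
  transitivity (dt * xi r * (alpha c j * beta c i)); last by ring.
  by rewrite -h10; ring.
- transitivity (xi r * xi r' * (beta c i * beta c j)); last by ring.
  have [->|_] := eqVneq r' r; first by rewrite -h1; ring.
  by rewrite -h3; ring.
Qed.

Variables (N : nat).
Variables (g : phase R N -> 'cV[R]_N) (gr : 'I_m -> phase R N -> 'cV[R]_N).
Variables (x : 'cV[R]_N).
Variables (Q0 P0 : 'I_s -> 'cV[R]_N) (Q P : 'I_m -> 'I_s -> 'cV[R]_N).

Definition flat_field : stage -> 'cV[R]_N :=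
  flatten_stages (fun j => g (Q0 j, P0 j)) (fun r j => gr r (Q r j, P r j)).

Lemma rk_stage0E i : rk_stage0 c dt xi g gr x Q0 P0 Q P i =
  x + \sum_l flat_matrix (inl i) l *: flat_field l.
Proof.
rewrite /rk_stage0 -addrA sum_stages scaler_sumr; congr (_ + (_ + _)).
  by apply: eq_bigr => j _; rewrite scalerA.
apply: eq_bigr => r _; rewrite scaler_sumr.
by apply: eq_bigr => j _; rewrite scalerA.
Qed.

Lemma rk_stageE l i : rk_stage c dt xi g gr x Q0 P0 Q P l i =
  x + \sum_k flat_matrix (inr (l, i)) k *: flat_field k.
Proof.
rewrite /rk_stage -!addrA sum_stages scaler_sumr; congr (_ + (_ + _)).
  by apply: eq_bigr => j _; rewrite scalerA.
rewrite [RHS](bigD1 l)//=; congr (_ + _).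
  by rewrite scaler_sumr; apply: eq_bigr => j _; rewrite scalerA eqxx.
apply: eq_bigr => r rl.
by rewrite scaler_sumr; apply: eq_bigr => j _; rewrite scalerA (negPf rl).
Qed.

Lemma rk_updateE : rk_update c dt xi g gr x Q0 P0 Q P =
  x + \sum_k flat_weight k *: flat_field k.
Proof. by rewrite /rk_update -addrA sum_flat_weight. Qed.

End Flattening.

(** * Applying the generating-function computation to the method *)

Theorem theorem3p8 (R : realType) (N m s : nat)
  (Sys : forced_system R N m) (HS : standing_assumptions Sys)
  (d : measure_display) (Omega : measurableType d) (Pr : probability Omega R)
  (dt : R) (dt_gt0 : 0 < dt)
  (Ihat : 'I_m -> {RV Pr >-> R})
  (Ihat_indep : mutually_independent Ihat)
  (Ihat_law : forall r, three_point_law dt (Ihat r))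
  (c : rk_coeffs R s) (Hc : rk_conditions c)
  (w : Omega)
  (U : set (phase R N)) (U_open : open U)
  (qn pk : phase R N -> 'cV[R]_N)
  (Q0 P0 : 'I_s -> phase R N -> 'cV[R]_N)
  (Q P : 'I_m -> 'I_s -> phase R N -> 'cV[R]_N)
  (stages_diff : differentiable_stages_on Q0 P0 Q P U)
  (method : rk_method_on Sys c dt (fun r => Ihat r w) qn pk Q0 P0 Q P U) :
  lagrange_dalembert_integrator_on U qn pk
    (discrete_ham Sys c dt (fun r => Ihat r w) qn Q0 P0 Q P)
    (discrete_force_minus Sys c dt (fun r => Ihat r w) Q0 P0 Q P)
    (discrete_force_plus Sys c dt (fun r => Ihat r w) Q0 P0 Q P).
Proof.
move=> z Uz.
(* The outcome [w] is fixed: the increments are real numbers and the argument is pathwise. *)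
pose xi r := Ihat r w.
pose h := flatten_stages (fun=> ham Sys) (fun r (_ : 'I_s) => sham Sys r).
pose Qs := flatten_stages Q0 Q.
pose Ps := flatten_stages P0 P.
(* Forces, and momentum velocities in [Y], are frozen at [z], as they are never differentiated. *)
pose f := flatten_stages (fun i => force Sys (Q0 i z, P0 i z))
  (fun r i => sforce Sys r (Q r i z, P r i z)).
pose Y := flat_field (drift_p Sys) (diff_p Sys)
  (Q0 ^~ z) (P0 ^~ z) (fun r i => Q r i z) (fun r i => P r i z).
pose wt := flat_weight c dt xi.
pose Hd y := dotv y.2 (qn y) - \sum_k wt k *
  (dotv (Ps k y) (grad2 (h k) (Qs k y, Ps k y)) - h k (Qs k y, Ps k y)).
have XE y : flat_field (drift_q Sys) (diff_q Sys)
    (Q0 ^~ y) (P0 ^~ y) (fun r i => Q r i y) (fun r i => P r i y) =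
    fun k => grad2 (h k) (Qs k y, Ps k y).
  by apply/funext => -[i|[r i]].
have [dQP0 dQP] := stages_diff z Uz.
have dQs k : differentiable (Qs k) z.
  by case: k => [i|[r i]] /=; [have [] := dQP0 i|have [] := dQP r i].
have dPs k : differentiable (Ps k) z.
  by case: k => [i|[r i]] /=; [have [] := dQP0 i|have [] := dQP r i].
(* Openness of [U] makes the method's equations hold near [z]. *)
have nearU : \forall y \near z, U y by exact: open_nbhs_nbhs.
have [[hamC2 shamC2] _ _ _] := HS.
have [stage0 stage qnz pnz] := method z Uz.
have dHd : is_diff z Hd (fun v => dotv v.2 (qn z) + dotv (pk z) v.1
    + \sum_k wt k * dotv (f k) ('d (Qs k) z v)).
  apply: (@is_diff_generating _ _ _ wt (flat_matrix c dt xi) h f Y qn (pk z)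
    Qs Ps z).
  - by move=> k l; exact: flat_matrix_symplectic.
  - by move=> [i|[r i]]; [exact: hamC2|exact: shamC2].
  - exact: dQs.
  - exact: dPs.
  - move=> k; apply: filterS nearU => y /method[st0 st _ _].
    case: k => [i|[r i]].
      by have [+ _] := st0 i; rewrite rk_stage0E XE; exact.
    by have [+ _] := st r i; rewrite rk_stageE XE; exact.
  - apply: filterS nearU => y /method[_ _ + _].
    by rewrite rk_updateE XE; exact.
  - move=> [i|[r i]].
      by have [_ +] := stage0 i; rewrite rk_stage0E; exact.
    by have [_ +] := stage r i; rewrite rk_stageE; exact.
  - by move: pnz; rewrite rk_updateE; exact.
  - by move=> [i|[r i]].
have HdE : discrete_ham Sys c dt xi qn Q0 P0 Q P = Hd.
  apply/funext => y; rewrite /discrete_ham /Hd.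
  (* [R^o] is the reals as a module over themselves, where scaling is multiplication. *)
  by rewrite (@sum_flat_weight _ _ _ _ _ _ R^o) opprD addrA.
have [g1 g2] := grad_of_is_diff dQs dHd.
(* Unflattened, the force sums in the gradients are exactly the discrete forces, and subtracting
   these leaves [pk z] and [qn z]. *)
rewrite sum_flat_weight in g1; rewrite sum_flat_weight in g2.
rewrite -/xi HdE g1 g2; split; first exact: ex_diff.
  by rewrite /discrete_force_plus addrK.
by rewrite /discrete_force_minus addrK.
Qed.
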